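(* Let $A\in\mathbb{Q}^{m\times n}$ be a quaternion matrix with nonzero singular values $\sigma_1\ge\sigma_2\ge\cdots\ge\sigma_r>0$, and let $\{X_j\}$ be the sequence generated by the QHPI19 iteration (defined in the context) from the initial iterate $X_0=\alpha A^{H}$, where $0<\alpha<\frac{2}{\sigma_1^2}$. Suppose that at the $j$th iteration a small numerical perturbation occurs such that $\tilde X_j=X_j+\Delta X_j$, where $\Delta X_j$ is sufficiently small so that terms of quadratic or higher order in $\Delta X_j$ may be neglected. Then the perturbation at the next iteration satisfies $$\|\Delta X_{j+1}\|\le\Gamma\,\|\Delta X_0\|,\qquad \Gamma=19^{\,j+1}\prod_{i=0}^{j}\max\{1,\|R_i\|^{18}\}\,\big(1+18\,\|A\|\,\|X_i\|\big),$$ where $R_i=I-AX_i$.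
   Context: $\mathbb{Q}$ denotes the skew field of real quaternions; $A^{H}=\overline{A}^{\top}$ is the conjugate transpose; singular values are those of the quaternion SVD $A=U\Sigma V^{H}$ ($U,V$ unitary quaternion matrices, $\Sigma$ real nonnegative diagonal). $\|\cdot\|$ is the operator 2-norm $\|A\|=\sup_{\|x\|_2=1}\|Ax\|_2$ with $\|x\|_2=\sqrt{x^{H}x}$. QHPI19 iteration: given $X_j\in\mathbb{Q}^{n\times m}$, with $I=I_m$, set $R_j=I-AX_j$, $U_j=(I+d_1R_j^2+R_j^4)(I+d_2R_j^2+R_j^4)$, $V_j=U_j+d_3R_j^2$, $W_j=U_j+e_1R_j^2+e_2R_j^4$, $\Gamma_j=V_jW_j+c_1R_j^2+c_2R_j^4$, $X_{j+1}=X_j\big(I+(R_j+R_j^2)\Gamma_j\big)$, with the real coefficients $d_1=\frac14\big(\sqrt{27-2\sqrt{93}}+1\big)$, $d_2=\frac14\big(1-\sqrt{27-2\sqrt{93}}\big)$, $d_3=\frac1{496}(5\sqrt{93}-93)$, $e_1=\frac1{496}(-93-5\sqrt{93})$, $e_2=-\frac{\sqrt{93}}4$, $c_1=\frac38$, $c_2=\frac{321}{1984}$. This update equals $X_{j+1}=X_j\sum_{k=0}^{18}R_j^{k}$. (The matrix $\Gamma_j$ of the iteration is unrelated to the scalar $\Gamma$ in the claim.) Perturbation notation: $\tilde X_{j+1}$ is obtained from the perturbed iterate $\tilde X_j$ by the same update, with $R_j$ replaced by $\tilde R_j=I-A\tilde X_j$. For each index $i$, $\Delta X_i=\tilde X_i-X_i$;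 in particular $\Delta X_0=\tilde X_0-X_0$ is the perturbation at iteration $0$. *)

(* Defs.v *)
From HB Require Import structures.
From mathcomp Require Import all_boot all_order all_algebra.
From mathcomp Require Import classical_sets reals.
From mathcomp Require Import ring.

Set Implicit Arguments.
Unset Strict Implicit.
Unset Printing Implicit Defensive.

Import Order.TTheory GRing.Theory Num.Theory.

Local Open Scope ring_scope.

(* [Quat a b c d] stands for a + b i + c j + d k. *)
Record quat (R : Type) : Type :=
  Quat { qre : R; qi : R; qj : R; qk : R }.

Definition quat_tuple (R : Type) (q : quat R) : R * R * R * R :=
  (qre q, qi q, qj q, qk q).

Definition tuple_quat (R : Type) (t : R * R * R * R) : quat R :=
  let: (a, b, c, d) := t in Quat a b c d.

Lemma quat_tupleK (R : Type) : cancel (@quat_tuple R) (@tuple_quat R).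
Proof. by case. Qed.

HB.instance Definition _ (R : eqType) :=
  Equality.copy (quat R) (can_type (@quat_tupleK R)).
HB.instance Definition _ (R : choiceType) :=
  Choice.copy (quat R) (can_type (@quat_tupleK R)).

Section QuatRing.
Variable R : comNzRingType.
Implicit Types p q r : quat R.

Definition quat0 : quat R := Quat 0 0 0 0.
Definition quat1 : quat R := Quat 1 0 0 0.

Definition oppq q : quat R := Quat (- qre q) (- qi q) (- qj q) (- qk q).

Definition addq p q : quat R :=
  Quat (qre p + qre q) (qi p + qi q) (qj p + qj q) (qk p + qk q).

Definition mulq p q : quat R :=
  let: Quat a1 b1 c1 d1 := p in
  let: Quat a2 b2 c2 d2 := q in
  Quat (a1 * a2 - b1 * b2 - c1 * c2 - d1 * d2)
       (a1 * b2 + b1 * a2 + c1 * d2 - d1 * c2)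
       (a1 * c2 - b1 * d2 + c1 * a2 + d1 * b2)
       (a1 * d2 + b1 * c2 - c1 * b2 + d1 * a2).

Lemma addqA : associative addq.
Proof. by move=> [? ? ? ?] [? ? ? ?] [? ? ? ?]; rewrite /addq /= !addrA. Qed.

Lemma addqC : commutative addq.
Proof. by move=> [? ? ? ?] [? ? ? ?]; congr Quat => /=; rewrite addrC. Qed.

Lemma add0q : left_id quat0 addq.
Proof. by move=> [? ? ? ?]; rewrite /addq /= !add0r. Qed.

Lemma addNq : left_inverse quat0 oppq addq.
Proof. by move=> [? ? ? ?]; rewrite /addq /= !addNr. Qed.

HB.instance Definition _ :=
  GRing.isZmodule.Build (quat R) addqA addqC add0q addNq.

Lemma mulqA : associative mulq.
Proof. by move=> [? ? ? ?] [? ? ? ?] [? ? ? ?]; congr Quat; ring. Qed.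

Lemma mul1q : left_id quat1 mulq.
Proof. by move=> [? ? ? ?]; congr Quat; ring. Qed.

Lemma mulq1 : right_id quat1 mulq.
Proof. by move=> [? ? ? ?]; congr Quat; ring. Qed.

Lemma mulqDl : left_distributive mulq addq.
Proof. by move=> [? ? ? ?] [? ? ? ?] [? ? ? ?]; congr Quat => /=; ring. Qed.

Lemma mulqDr : right_distributive mulq addq.
Proof. by move=> [? ? ? ?] [? ? ? ?] [? ? ? ?]; congr Quat => /=; ring. Qed.

Lemma oneq_neq0 : quat1 != quat0.
Proof. by apply/eqP => -[] /eqP; rewrite oner_eq0. Qed.

HB.instance Definition _ :=
  GRing.Zmodule_isNzRing.Build (quat R)
    mulqA mul1q mulq1 mulqDl mulqDr oneq_neq0.

Definition qreal (a : R) : quat R := Quat a 0 0 0.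

Definition qconj q : quat R := Quat (qre q) (- qi q) (- qj q) (- qk q).

End QuatRing.

Definition adjmx (R : comNzRingType) (m n : nat) (A : 'M[quat R]_(m, n)) :
    'M[quat R]_(n, m) := map_mx (@qconj R) A^T.

Notation "A ^H" := (adjmx A) (at level 1, format "A ^H") : ring_scope.

Definition quat_unitarymx (R : comNzRingType) (n : nat) (U : 'M[quat R]_n) : Prop :=
  U^H *m U = 1%:M /\ U *m U^H = 1%:M.

Section Quaternion_matrices.
Variable R : realType.

(* The unique entry of x^H x is a nonnegative real quaternion. *)
Definition norm2 (n : nat) (x : 'cV[quat R]_n) : R :=
  Num.sqrt (qre ((x^H *m x) 0 0)).

(* [sup set0 = 0], so the norm is 0 when there are no columns. *)
Definition opnorm (m n : nat) (A : 'M[quat R]_(m, n)) : R :=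
  sup [set norm2 (A *m x) | x in [set x : 'cV[quat R]_n | norm2 x = 1]]%classic.

(* [s] lists the nonzero singular values of [A] in nonincreasing order, with
   multiplicity: A = U Sigma V^H where the diagonal of Sigma is [s] followed by
   zeros ([s`_i] is 0 beyond the end of [s]). *)
Definition nonzero_singular_values (m n : nat) (A : 'M[quat R]_(m, n))
    (s : seq R) : Prop :=
  [/\ (size s <= minn m n)%N,
      sorted >=%R s,
      all (fun x => 0 < x) s &
      exists (U : 'M[quat R]_m) (V : 'M[quat R]_n),
        [/\ quat_unitarymx U, quat_unitarymx V &
            A = U *m (\matrix_(i < m, j < n)
                        (if i == j :> nat then qreal s`_i else 0)) *m V^H]].

Definition qhpi_d1 : R := (Num.sqrt (27 - 2 * Num.sqrt 93) + 1) / 4.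
Definition qhpi_d2 : R := (1 - Num.sqrt (27 - 2 * Num.sqrt 93)) / 4.
Definition qhpi_d3 : R := (5 * Num.sqrt 93 - 93) / 496.
Definition qhpi_e1 : R := (- 93 - 5 * Num.sqrt 93) / 496.
Definition qhpi_e2 : R := - Num.sqrt 93 / 4.
Definition qhpi_c1 : R := 3 / 8.
Definition qhpi_c2 : R := 321 / 1984.

Definition qhpi19_step (m n : nat) (A : 'M[quat R]_(m, n))
    (X : 'M[quat R]_(n, m)) : 'M[quat R]_(n, m) :=
  let Rj : 'M[quat R]_m := 1 - A *m X in
  let Uj := (1 + qreal qhpi_d1 *: Rj ^+ 2 + Rj ^+ 4)
          * (1 + qreal qhpi_d2 *: Rj ^+ 2 + Rj ^+ 4) in
  let Vj := Uj + qreal qhpi_d3 *: Rj ^+ 2 in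
  let Wj := Uj + qreal qhpi_e1 *: Rj ^+ 2 + qreal qhpi_e2 *: Rj ^+ 4 in
  let Gj := Vj * Wj + qreal qhpi_c1 *: Rj ^+ 2 + qreal qhpi_c2 *: Rj ^+ 4 in
  X *m (1 + (Rj + Rj ^+ 2) * Gj).

(* The scalar amplification factor of a perturbation from index 0 to [j.+1]. *)
Definition perturbation_factor (m n : nat) (A : 'M[quat R]_(m, n))
    (X : nat -> 'M[quat R]_(n, m)) (j : nat) : R :=
  19 ^+ j.+1 *
  \prod_(0 <= i < j.+1)
     (Num.max 1 (opnorm (1 - A *m X i) ^+ 18)
      * (1 + 18 * opnorm A * opnorm (X i))).

End Quaternion_matrices.

(* Main.v *)
Require Import Defs.
From HB Require Import structures.
From mathcomp Require Import all_boot all_order all_algebra.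
From mathcomp Require Import boolp classical_sets reals.
From mathcomp Require Import ring lra.

Set Implicit Arguments.
Unset Strict Implicit.
Unset Printing Implicit Defensive.

Import Order.TTheory GRing.Theory Num.Theory.

Local Open Scope ring_scope.

(** Write [F X = qhpi19_step A X] and [T = 1 - A X] for the residual of [X].
    The coefficients are chosen so that [F X = X (1 + T + ... + T ^+ 18)]
    ([qhpi19_stepE]). Hence, with [S] the residual of [Y] and [D = Y - X],
      [F Y - F X = D \sum_k S ^+ k + X \sum_k (S ^+ k - T ^+ k)],
    where [S - T = - A D]. Telescoping [S ^+ k - T ^+ k] and bounding the powers
    of [S] and [T] by those of any common bound [L >= 1] gives
      [|F Y - F X| <= 19 L ^+ 18 (1 + 9 |A| |X|) |D|]
    ([qhpi19_step_lipschitz]); the 9 is [(0 + 1 + ... + 18) / 19].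

    When [D] tends to 0 one may let [L] tend to [max 1 |T|]. The factor of the
    theorem has 18 in place of 9, so if [|A| |X| > 0] there is room to spare and
    the bound of the theorem, for a single step, holds exactly for all small
    [D], nonlinear terms included ([qhpi19_step_local]).

    The room is there at every index: on a left singular vector [v] for the
    largest singular value, the initial residual acts as the scalar
    [1 - alpha * sigma_0 ^+ 2], which lies strictly between [-1] and 1, and
    residuals are raised to the power 19 at each step. No residual is therefore
    the identity, that is, [A X_i != 0] ([orbit_mulmx_neq0]).

    Composing the one-step bounds settles the case of a small initial
    perturbation ([orbit_local]). The hypothesis only makes the perturbation at
    index [j] small; if the initial one exceeds a fixed [eps], then one more step
    from a sufficiently small perturbation stays below the factor times [eps]. *)

(** * Quaternions over the reals and their matrices *)

Section QuaternionAlgebra.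
Variable R : realType.
Implicit Types p q : quat R.

Definition qdot p q : R :=
  qre p * qre q + qi p * qi q + qj p * qj q + qk p * qk q.

Lemma qdotE p q : qdot p q = qre (qconj p * q).
Proof. by case: p q => [a b c d] [a' b' c' d']; rewrite /qdot /=; ring. Qed.

Lemma qdot_ge0 q : 0 <= qdot q q.
Proof. by rewrite /qdot !addr_ge0 // -expr2 sqr_ge0. Qed.

Lemma qdot_eq0 q : (qdot q q == 0) = (q == 0).
Proof.
apply/eqP/eqP => [|->]; last by rewrite /qdot /= !mulr0 !addr0.
case: q => a b c d; rewrite /qdot /= => h.
have [a2 b2 c2 d2] := And4 (sqr_ge0 a) (sqr_ge0 b) (sqr_ge0 c) (sqr_ge0 d).
have z (x : R) : x ^+ 2 = 0 -> x = 0 by move/eqP; rewrite sqrf_eq0 => /eqP.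
by congr Quat; apply: z; lra.
Qed.

(** Euler's four-square identity. *)
Lemma qdotM p q : qdot (p * q) (p * q) = qdot p p * qdot q q.
Proof. by case: p q => [a b c d] [a' b' c' d']; rewrite /qdot /=; ring. Qed.

Lemma qdotDl p p' q : qdot (p + p') q = qdot p q + qdot p' q.
Proof. by rewrite /qdot /=; ring. Qed.

Lemma qdotZl (a : R) p q : qdot (qreal a * p) q = a * qdot p q.
Proof. by case: p q => [? ? ? ?] [? ? ? ?]; rewrite /qdot /=; ring. Qed.

Lemma qdotC p q : qdot p q = qdot q p.
Proof. by rewrite /qdot; ring. Qed.

Fact qre_is_zmod_morphism : zmod_morphism (@qre R).
Proof. by []. Qed.
HB.instance Definition _ :=
  GRing.isZmodMorphism.Build (quat R) R (@qre R) qre_is_zmod_morphism.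

Fact qreal_is_zmod_morphism : zmod_morphism (@qreal R).
Proof. by move=> a b; congr Quat => /=; ring. Qed.
Fact qreal_is_monoid_morphism : monoid_morphism (@qreal R).
Proof. by split=> // a b; congr Quat => /=; ring. Qed.
HB.instance Definition _ :=
  GRing.isZmodMorphism.Build R (quat R) (@qreal R) qreal_is_zmod_morphism.
HB.instance Definition _ :=
  GRing.isMonoidMorphism.Build R (quat R) (@qreal R) qreal_is_monoid_morphism.

Lemma qreal_comm (a : R) q : qreal a * q = q * qreal a.
Proof. by case: q => ? ? ? ?; congr Quat => /=; ring. Qed.

Fact qconj_is_zmod_morphism : zmod_morphism (@qconj R).
Proof. by move=> p q; congr Quat => /=; ring. Qed.
HB.instance Definition _ :=
  GRing.isZmodMorphism.Build (quat R) (quat R) (@qconj R) qconj_is_zmod_morphism.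

Lemma qconjM p q : qconj (p * q) = qconj q * qconj p.
Proof. by case: p q => [? ? ? ?] [? ? ? ?]; congr Quat => /=; ring. Qed.

Lemma qconjK : involutive (@qconj R).
Proof. by case=> ? ? ? ?; congr Quat => /=; ring. Qed.

Lemma qconj_real (a : R) : qconj (qreal a) = qreal a.
Proof. by congr Quat => /=; ring. Qed.

Lemma scalerealmxAr (m n p : nat) (a : R) (A : 'M[quat R]_(m, n))
    (B : 'M[quat R]_(n, p)) : A *m (qreal a *: B) = qreal a *: (A *m B).
Proof.
apply/matrixP => i j; rewrite !mxE mulr_sumr; apply: eq_bigr => k _.
by rewrite !mxE !mulrA qreal_comm.
Qed.

Lemma adjmxM (m n p : nat) (A : 'M[quat R]_(m, n)) (B : 'M[quat R]_(n, p)) :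
  (A *m B)^H = B^H *m A^H.
Proof.
apply/matrixP => i j; rewrite !mxE raddf_sum; apply: eq_bigr => k _.
by rewrite !mxE /= qconjM.
Qed.

Lemma adjmxK (m n : nat) (A : 'M[quat R]_(m, n)) : A^H^H = A.
Proof. by apply/matrixP => i j; rewrite !mxE qconjK. Qed.

End QuaternionAlgebra.

(** * The Euclidean norm of quaternion vectors *)

Section VectorNorm.
Variables (R : realType) (n : nat).
Implicit Types x y : 'cV[quat R]_n.

Definition vdot x y : R := \sum_i qdot (x i 0) (y i 0).

Lemma norm2E x : norm2 x = Num.sqrt (vdot x x).
Proof.
congr Num.sqrt; rewrite mxE raddf_sum; apply: eq_bigr => i _.
by rewrite !mxE /= -qdotE.
Qed.

Lemma vdot_ge0 x : 0 <= vdot x x.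
Proof. by apply: sumr_ge0 => i _; exact: qdot_ge0. Qed.

Lemma vdotC x y : vdot x y = vdot y x.
Proof. by apply: eq_bigr => i _; rewrite qdotC. Qed.

Lemma vdotDl x x' y : vdot (x + x') y = vdot x y + vdot x' y.
Proof. by rewrite -big_split; apply: eq_bigr => i _; rewrite mxE qdotDl. Qed.

Lemma vdotZl a x y : vdot (qreal a *: x) y = a * vdot x y.
Proof. by rewrite mulr_sumr; apply: eq_bigr => i _; rewrite mxE qdotZl. Qed.

Lemma vdot_eq0 x : (vdot x x == 0) = (x == 0).
Proof.
rewrite psumr_eq0; last by move=> i _; exact: qdot_ge0.
apply/allP/eqP => [h|-> i _ /=]; last by rewrite qdot_eq0 mxE.
apply/matrixP => i j; rewrite ord1 mxE; apply/eqP.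
by rewrite -qdot_eq0; apply: h; rewrite mem_index_enum.
Qed.

(** Cauchy-Schwarz for the real inner product underlying [norm2]: expand the
    square of the component of [x] orthogonal to [y], cleared of denominators. *)
Lemma vdot_CauchySchwarz x y : vdot x y ^+ 2 <= vdot x x * vdot y y.
Proof.
have [->|yN0] := eqVneq y 0.
  have v0 z : vdot z 0 = 0.
    by apply: big1 => i _; rewrite mxE /qdot /= !mulr0 !addr0.
  by rewrite !v0 expr0n mulr0.
set a := vdot x x; set b := vdot y y; set c := vdot x y.
have b_gt0 : 0 < b by rewrite lt_def vdot_eq0 yN0 vdot_ge0.
have := vdot_ge0 (qreal b *: x + qreal (- c) *: y).
rewrite vdotDl !vdotZl [vdot x _]vdotC [vdot y (_ + _)]vdotC !vdotDl !vdotZl.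
rewrite [vdot y x]vdotC -/a -/b -/c.
rewrite (_ : _ + _ = b * (a * b - c ^+ 2)); last by ring.
by rewrite pmulr_rge0 // subr_ge0.
Qed.

Lemma norm2_ge0 x : 0 <= norm2 x.
Proof. exact: sqrtr_ge0. Qed.

Lemma norm2_sqr x : norm2 x ^+ 2 = vdot x x.
Proof. by rewrite norm2E sqr_sqrtr // vdot_ge0. Qed.

Lemma norm2_eq0 x : (norm2 x == 0) = (x == 0).
Proof. by rewrite -sqrf_eq0 norm2_sqr vdot_eq0. Qed.

Lemma norm20 : norm2 (0 : 'cV[quat R]_n) = 0.
Proof. by apply/eqP; rewrite norm2_eq0. Qed.

Lemma norm2Z a x : norm2 (qreal a *: x) = `|a| * norm2 x.
Proof.
rewrite norm2E vdotZl vdotC vdotZl mulrA -expr2 sqrtrM ?sqr_ge0 //.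
by rewrite sqrtr_sqr norm2E.
Qed.

Lemma norm2D x y : norm2 (x + y) <= norm2 x + norm2 y.
Proof.
rewrite -(ler_pXn2r (n := 2)) ?nnegrE ?addr_ge0 ?norm2_ge0 //.
rewrite sqrrD !norm2_sqr vdotDl vdotC vdotDl [vdot y (_ + _)]vdotC vdotDl.
rewrite [vdot y x]vdotC.
have : vdot x y <= norm2 x * norm2 y.
  rewrite (le_trans (ler_norm _)) //.
  rewrite -(ler_pXn2r (n := 2)) ?nnegrE ?mulr_ge0 ?norm2_ge0 //.
  by rewrite exprMn !norm2_sqr real_normK ?num_real // vdot_CauchySchwarz.
by rewrite mulr2n; lra.
Qed.

Lemma norm2_sum (I : finType) (F : I -> 'cV[quat R]_n) :
  norm2 (\sum_i F i) <= \sum_i norm2 (F i).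
Proof.
elim/big_rec2: _ => [|i b a _ hab]; first by rewrite norm20.
by rewrite (le_trans (norm2D _ _)) // lerD2l.
Qed.

End VectorNorm.

(** * The operator norm *)

Section OperatorNorm.
Variable R : realType.

(** A crude bound, from [A x = \sum_j (column j) * x_j]; only its finiteness
    matters. *)
Lemma norm2_mulmx_le (m n : nat) (A : 'M[quat R]_(m, n)) (x : 'cV_n) :
  norm2 (A *m x) <= (\sum_j norm2 (col j A)) * norm2 x.
Proof.
have -> : A *m x = \sum_j col j A *m (x j 0)%:M.
  apply/matrixP => i k; rewrite ord1 mxE summxE; apply: eq_bigr => j _.
  by rewrite !mxE big_ord1 !mxE eqxx mulr1n.
rewrite (le_trans (norm2_sum _)) // mulr_suml; apply: ler_sum => j _.
rewrite -(ler_pXn2r (n := 2)) ?nnegrE ?mulr_ge0 ?norm2_ge0 //.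
rewrite exprMn !norm2_sqr.
have -> : vdot (col j A *m (x j 0)%:M) (col j A *m (x j 0)%:M)
          = vdot (col j A) (col j A) * qdot (x j 0) (x j 0).
  rewrite mulr_suml; apply: eq_bigr => i _.
  by rewrite !mxE big_ord1 !mxE eqxx mulr1n qdotM.
rewrite ler_wpM2l ?vdot_ge0 // /vdot (bigD1 j) //= lerDl sumr_ge0 // => i _.
exact: qdot_ge0.
Qed.

Let unit_images (m n : nat) (A : 'M[quat R]_(m, n)) : set R :=
  [set norm2 (A *m x) | x in [set x : 'cV[quat R]_n | norm2 x = 1]]%classic.

(** The columns of [A] bound it on the unit sphere, so that the supremum
    defining [opnorm] is a genuine upper bound; homogeneity does the rest. *)
Lemma norm2_mulmx (m n : nat) (A : 'M[quat R]_(m, n)) (x : 'cV_n) :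
  norm2 (A *m x) <= opnorm A * norm2 x.
Proof.
have [->|xN0] := eqVneq x 0; first by rewrite mulmx0 !norm20 mulr0.
have x_gt0 : 0 < norm2 x by rewrite lt_def norm2_eq0 xN0 norm2_ge0.
rewrite -ler_pdivrMr // mulrC.
have -> : (norm2 x)^-1 * norm2 (A *m x) = norm2 (A *m (qreal (norm2 x)^-1 *: x)).
  by rewrite scalerealmxAr norm2Z ger0_norm // invr_ge0 norm2_ge0.
apply: (@ub_le_sup _ (unit_images A)); last first.
  exists (qreal (norm2 x)^-1 *: x) => //=.
  by rewrite norm2Z ger0_norm ?invr_ge0 ?norm2_ge0 // mulVf ?gt_eqF.
exists (\sum_j norm2 (col j A)) => _ [y /= y1 <-].
by rewrite (le_trans (norm2_mulmx_le _ _)) // y1 mulr1.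
Qed.

(** The case distinction is on whether the unit sphere is empty, which it is
    when there are no columns; the supremum is then 0 by convention. *)
Lemma opnorm_le (m n : nat) (A : 'M[quat R]_(m, n)) (C : R) :
  0 <= C -> (forall x, norm2 (A *m x) <= C * norm2 x) -> opnorm A <= C.
Proof.
move=> C_ge0 hC; rewrite /opnorm -/(unit_images A).
have [[v v_in]|none] := pselect (exists v, unit_images A v).
  apply: ge_sup; first by exists v.
  by move=> _ [y /= y1 <-]; rewrite -[C]mulr1 -y1.
by rewrite sup_out // => -[[v v_in] _]; apply: none; exists v.
Qed.

Lemma opnorm_ge0 (m n : nat) (A : 'M[quat R]_(m, n)) : 0 <= opnorm A.
Proof.
rewrite /opnorm -/(unit_images A).
have [[v v_in]|none] := pselect (exists v, unit_images A v); last first.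
  by rewrite sup_out // => -[[v v_in] _]; apply: none; exists v.
case: v_in => y /= y1 _; have := norm2_mulmx A y.
by rewrite y1 mulr1; apply: le_trans; exact: norm2_ge0.
Qed.

Lemma opnormD (m n : nat) (A B : 'M[quat R]_(m, n)) :
  opnorm (A + B) <= opnorm A + opnorm B.
Proof.
apply: opnorm_le => [|x]; first by rewrite addr_ge0 ?opnorm_ge0.
by rewrite mulmxDl (le_trans (norm2D _ _)) // mulrDl lerD ?norm2_mulmx.
Qed.

Lemma opnormM (m n p : nat) (A : 'M[quat R]_(m, n)) (B : 'M[quat R]_(n, p)) :
  opnorm (A *m B) <= opnorm A * opnorm B.
Proof.
apply: opnorm_le => [|x]; first by rewrite mulr_ge0 ?opnorm_ge0.
rewrite -mulmxA (le_trans (norm2_mulmx _ _)) // -mulrA.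
by rewrite ler_wpM2l ?opnorm_ge0 ?norm2_mulmx.
Qed.

Lemma opnorm0 (m n : nat) : opnorm (0 : 'M[quat R]_(m, n)) = 0.
Proof.
apply/le_anti; rewrite opnorm_ge0 andbT.
by apply: opnorm_le => // x; rewrite mul0mx norm20 mul0r.
Qed.

Lemma opnorm_eq0 (m n : nat) (A : 'M[quat R]_(m, n)) :
  opnorm A = 0 -> A = 0.
Proof.
move=> A0; apply/matrixP => i j; rewrite [RHS]mxE.
have := norm2_mulmx A (delta_mx j 0); rewrite A0 mul0r => /le_trans le0.
have /eqP : norm2 (A *m delta_mx j 0) == 0 by rewrite eq_le norm2_ge0 le0.
move/eqP; rewrite norm2_eq0 -colE => /eqP /matrixP /(_ i 0).
by rewrite !mxE.
Qed.

Lemma opnormN (m n : nat) (A : 'M[quat R]_(m, n)) : opnorm (- A) = opnorm A.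
Proof.
have le_opp (B : 'M[quat R]_(m, n)) : opnorm (- B) <= opnorm B.
  apply: opnorm_le => [|x]; first exact: opnorm_ge0.
  have -> : - B *m x = qreal (-1) *: (B *m x).
    by rewrite rmorphN1 scaleN1r mulNmx.
  by rewrite norm2Z normrN1 mul1r norm2_mulmx.
by apply/le_anti; rewrite le_opp -{1}[A]opprK le_opp.
Qed.

Lemma opnorm_sum (m n k : nat) (F : 'I_k -> 'M[quat R]_(m, n)) :
  opnorm (\sum_i F i) <= \sum_i opnorm (F i).
Proof.
elim/big_rec2: _ => [|i b a _ hab]; first by rewrite opnorm0.
by rewrite (le_trans (opnormD _ _)) // lerD2l.
Qed.

Lemma opnormX_le (m k : nat) (A : 'M[quat R]_m) (L : R) :
  opnorm A <= L -> opnorm (A ^+ k) <= L ^+ k.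
Proof.
move=> AL; have L_ge0 : 0 <= L := le_trans (opnorm_ge0 A) AL.
elim: k => [|k IHk].
  by rewrite expr0; apply: opnorm_le => // x; rewrite mul1mx mul1r.
by rewrite !exprS (le_trans (opnormM _ _)) // ler_pM ?opnorm_ge0.
Qed.

End OperatorNorm.

(** * The update is a truncated Neumann series *)

Section UpdatePolynomial.
Variable R : realType.

(** Coefficient by coefficient in [y = x ^+ 2], what it takes for
    [V * W + c1 y + c2 y ^+ 2] to be [1 + y + ... + y ^+ 8]. *)
Definition neumann_relations (C : comNzRingType)
    (d1 d2 d3 e1 e2 c1 c2 : C) : Prop :=
  let p := d1 + d2 in let q := 2 + d1 * d2 in
  [/\ 2 * p + d3 + e1 + c1 = 1,
      2 * q + e2 + (p + d3) * (p + e1) + c2 = 1,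
      2 * p + (p + d3) * (q + e2) + q * (p + e1) = 1 &
      2 + (p + d3) * p + q * (q + e2) + p * (p + e1) = 1] /\
  [/\ (p + d3) + (p + e1) + q * p + p * (q + e2) = 1,
      2 * q + e2 + p ^+ 2 = 1 &
      2 * p = 1].

Lemma neumann_relationsP (C : comNzRingType) (d1 d2 d3 e1 e2 c1 c2 x : C) :
    neumann_relations d1 d2 d3 e1 e2 c1 c2 ->
  let U := (1 + d1 * x ^+ 2 + x ^+ 4) * (1 + d2 * x ^+ 2 + x ^+ 4) in
  let V := U + d3 * x ^+ 2 in
  let W := U + e1 * x ^+ 2 + e2 * x ^+ 4 in
  let G := V * W + c1 * x ^+ 2 + c2 * x ^+ 4 in
  1 + (x + x ^+ 2) * G = \sum_(k < 19) x ^+ k.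
Proof.
rewrite /neumann_relations.
set p := d1 + d2; set q := 2 + d1 * d2 => -[[h1 h2 h3 h4] [h5 h6 h7]] /=.
set y := x ^+ 2.
transitivity (1 + (x + y) * (1
   + (2 * p + d3 + e1 + c1) * y
   + (2 * q + e2 + (p + d3) * (p + e1) + c2) * y ^+ 2
   + (2 * p + (p + d3) * (q + e2) + q * (p + e1)) * y ^+ 3
   + (2 + (p + d3) * p + q * (q + e2) + p * (p + e1)) * y ^+ 4
   + ((p + d3) + (p + e1) + q * p + p * (q + e2)) * y ^+ 5
   + (2 * q + e2 + p ^+ 2) * y ^+ 6
   + 2 * p * y ^+ 7 + y ^+ 8)).
  by rewrite (_ : x ^+ 4 = y ^+ 2) /p /q /y -?exprM //; ring.
by rewrite h1 h2 h3 h4 h5 h6 h7 /y !big_ord_recr big_ord0 /=; ring.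
Qed.

Lemma neumann_relations_qhpi :
  neumann_relations (qhpi_d1 R) (qhpi_d2 R) (qhpi_d3 R) (qhpi_e1 R)
    (qhpi_e2 R) (qhpi_c1 R) (qhpi_c2 R).
Proof.
pose s : R := Num.sqrt 93.
have s2 : s ^+ 2 = 93 by rewrite sqr_sqrtr // ler0n.
have s_ge0 : 0 <= s by exact: sqrtr_ge0.
pose t : R := Num.sqrt (27 - 2 * s).
have t2 : t ^+ 2 = 27 - 2 * s by rewrite sqr_sqrtr //; nra.
have dd : qhpi_d1 R + qhpi_d2 R = 1 / 2.
  by rewrite /qhpi_d1 /qhpi_d2 -/s -/t; field.
have dm : qhpi_d1 R * qhpi_d2 R = (s - 13) / 8.
  rewrite /qhpi_d1 /qhpi_d2 -/s -/t.
  have -> : (t + 1) / 4 * ((1 - t) / 4) = (1 - t ^+ 2) / 16 by field.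
  by rewrite t2; field.
rewrite /neumann_relations /= dd dm.
rewrite /qhpi_d3 /qhpi_e1 /qhpi_e2 /qhpi_c1 /qhpi_c2 -/s.
by do !split; nra.
Qed.

Lemma neumann_relations_polyC (d1 d2 d3 e1 e2 c1 c2 : R) :
  neumann_relations d1 d2 d3 e1 e2 c1 c2 ->
  neumann_relations d1%:P d2%:P d3%:P e1%:P e2%:P c1%:P c2%:P.
Proof.
move=> [[h1 h2 h3 h4] [h5 h6 h7]].
have polyC2 : 2 = 2%:P :> {poly R} by rewrite rmorph_nat.
rewrite /neumann_relations polyC2 -?(polyCD, polyCM, polyC_exp).
by rewrite h1 h2 h3 h4 h5 h6 h7.
Qed.

(** Real scalars are central among the quaternions, so real polynomials can be
    evaluated at a quaternion matrix although its entries do not commute. *)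
Lemma poly_eval_mx (m : nat) (B : 'M[quat R]_m.+1) :
  exists phi : {rmorphism {poly R} -> 'M[quat R]_m.+1},
    phi 'X = B /\ forall a p, phi (a%:P * p) = qreal a *: phi p.
Proof.
pose f (a : R) : 'M[quat R]_m.+1 := (qreal a)%:M.
have f_zmod : zmod_morphism f by move=> a b; rewrite /f !raddfB.
have f_monoid : monoid_morphism f.
  by split=> [|a b]; rewrite /f ?rmorph1 // rmorphM /= scalar_mxM.
pose fA := GRing.isZmodMorphism.Build _ _ f f_zmod.
pose fM := GRing.isMonoidMorphism.Build _ _ f f_monoid.
pose F : {rmorphism R -> 'M[quat R]_m.+1} := HB.pack f fA fM.
have cF : commr_rmorph F B.
  move=> a; have := scalerealmxAr a B 1%:M.
  by rewrite mulmx1 scalemx1 -[qreal a *: B]mul_scalar_mx.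
exists (horner_morph cF : {rmorphism {poly R} -> _}).
split=> [|a p]; first exact: horner_morphX.
by rewrite rmorphM /= [X in X * _](horner_morphC cF a) -[LHS]/(_ *m _) mul_scalar_mx.
Qed.

(** The update is the truncated Neumann series: the factored form is an
    identity between real polynomials, evaluated at the residual. *)
Lemma qhpi19_stepE (m n : nat) (A : 'M[quat R]_(m, n)) (X : 'M[quat R]_(n, m)) :
  qhpi19_step A X = X *m \sum_(k < 19) (1 - A *m X) ^+ k.
Proof.
case: m A X => [|m] A X; first by rewrite [LHS]thinmx0 [RHS]thinmx0.
rewrite /qhpi19_step; congr (X *m _).
have [phi [phiX phiZ]] := poly_eval_mx (1 - A *m X).
rewrite -phiX; move: phi phiZ {phiX} => phi phiZ.
have pD := rmorphD phi; have pM := rmorphM phi; have p1 := rmorph1 phi.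
have pX k : phi ('X ^+ k) = phi 'X ^+ k by rewrite rmorphXn.
transitivity (phi (\sum_(k < 19) 'X ^+ k)); last first.
  by rewrite rmorph_sum; apply: eq_bigr => k _; rewrite pX.
rewrite -(neumann_relationsP _ (neumann_relations_polyC neumann_relations_qhpi)).
by do ![rewrite phiZ | rewrite pD | rewrite p1 | rewrite pX | rewrite pM].
Qed.

End UpdatePolynomial.

(** * Growth of a perturbation in one step *)

Section OneStep.
Variable R : realType.

(** Telescoping; the exponent [k] instead of [k - 1] costs nothing, as [1 <= L],
    and avoids a special case at [k = 0]. *)
Lemma opnorm_subX (m k : nat) (P Q : 'M[quat R]_m) (L : R) :
    1 <= L -> opnorm P <= L -> opnorm Q <= L ->
  opnorm (P ^+ k - Q ^+ k) <= k%:R * L ^+ k * opnorm (P - Q).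
Proof.
move=> L1 PL QL; have L0 : 0 <= L := le_trans ler01 L1.
elim: k => [|k IHk]; first by rewrite !expr0 subrr opnorm0 !mul0r.
have -> : P ^+ k.+1 - Q ^+ k.+1 = P *m (P ^+ k - Q ^+ k) + (P - Q) *m Q ^+ k.
  by rewrite mulmxBr mulmxBl !exprS addrA subrK.
apply: le_trans (opnormD _ _) _.
have hP : opnorm (P *m (P ^+ k - Q ^+ k))
          <= k%:R * L ^+ k.+1 * opnorm (P - Q).
  apply: le_trans (opnormM _ _) _; rewrite exprS.
  rewrite (_ : _ * _ * _ = L * (k%:R * L ^+ k * opnorm (P - Q))); last by ring.
  exact: ler_pM (opnorm_ge0 _) (opnorm_ge0 _) PL IHk.
have hQ : opnorm ((P - Q) *m Q ^+ k) <= L ^+ k.+1 * opnorm (P - Q).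
  apply: le_trans (opnormM _ _) _; rewrite mulrC; apply: ler_wpM2r.
    exact: opnorm_ge0.
  exact: le_trans (opnormX_le k QL) (ler_weXn2l L1 (leqnSn k)).
by apply: le_trans (lerD hP hQ) _; rewrite -natr1 !mulrDl mul1r.
Qed.

(** Split the increment as
    [(Y - X) \sum_k S ^+ k + X \sum_k (S ^+ k - T ^+ k)], where [S] and [T] are
    the residuals of [Y] and [X] and [S - T = - A (Y - X)]. The first sum
    contributes [19], the second [\sum_(k < 19) k = 171 = 19 * 9]. *)
Lemma qhpi19_step_lipschitz (m n : nat) (A : 'M[quat R]_(m, n))
    (X Y : 'M[quat R]_(n, m)) (L : R) :
    1 <= L -> opnorm (1 - A *m X) <= L -> opnorm (1 - A *m Y) <= L ->
  opnorm (qhpi19_step A Y - qhpi19_step A X)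
    <= 19 * L ^+ 18 * (1 + 9 * opnorm A * opnorm X) * opnorm (Y - X).
Proof.
move=> L1 XL YL; have L0 : 0 <= L := le_trans ler01 L1.
rewrite !qhpi19_stepE; set S := 1 - A *m Y; set T := 1 - A *m X.
have expL (k : 'I_19) : L ^+ k <= L ^+ 18.
  by rewrite ler_weXn2l // -ltnS.
have L18 : 0 <= L ^+ 18 by rewrite exprn_ge0.
have ST : opnorm (S - T) <= opnorm A * opnorm (Y - X).
  have -> : S - T = - (A *m (Y - X)).
    by rewrite mulmxBr /S /T !opprB addrC addrA subrK.
  by rewrite opnormN opnormM.
have -> : Y *m \sum_(k < 19) S ^+ k - X *m \sum_(k < 19) T ^+ k
          = (Y - X) *m \sum_(k < 19) S ^+ k + X *m \sum_(k < 19) (S ^+ k - T ^+ k).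
  by rewrite sumrB mulmxBr mulmxBl addrA subrK.
have h1 : opnorm (\sum_(k < 19) S ^+ k) <= 19 * L ^+ 18.
  apply: le_trans (opnorm_sum _) _.
  have -> : 19 * L ^+ 18 = \sum_(k < 19) L ^+ 18.
    by rewrite sumr_const card_ord mulr_natl.
  by apply: ler_sum => k _; rewrite (le_trans (opnormX_le _ YL)).
have h2 : opnorm (\sum_(k < 19) (S ^+ k - T ^+ k))
          <= 171 * (L ^+ 18 * (opnorm A * opnorm (Y - X))).
  apply: le_trans (opnorm_sum _) _.
  have -> : 171 * (L ^+ 18 * (opnorm A * opnorm (Y - X)))
            = \sum_(k < 19) k%:R * (L ^+ 18 * (opnorm A * opnorm (Y - X))).
    rewrite -mulr_suml; congr (_ * _).
    by rewrite !big_ord_recr big_ord0 /=; ring.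
  apply: ler_sum => k _; rewrite (le_trans (opnorm_subX _ L1 YL XL)) //.
  rewrite -mulrA ler_wpM2l // ler_pM ?opnorm_ge0 ?exprn_ge0 //.
apply: le_trans (opnormD _ _) _.
have k1 : opnorm ((Y - X) *m \sum_(k < 19) S ^+ k)
          <= opnorm (Y - X) * (19 * L ^+ 18).
  by rewrite (le_trans (opnormM _ _)) // ler_wpM2l ?opnorm_ge0.
have k2 : opnorm (X *m \sum_(k < 19) (S ^+ k - T ^+ k))
          <= opnorm X * (171 * (L ^+ 18 * (opnorm A * opnorm (Y - X)))).
  by rewrite (le_trans (opnormM _ _)) // ler_wpM2l ?opnorm_ge0.
apply: le_trans (lerD k1 k2) _.
move: (opnorm (Y - X)) (opnorm A) (opnorm X) (L ^+ 18) => d a x l.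
by rewrite le_eqVlt; apply/orP; left; apply/eqP; ring.
Qed.

(** Continuity at [s] of the [n]-th power, in relative form. The witness comes
    from [(1 + h) ^+ n <= 1 + (2 ^+ n - 1) h] for [0 <= h <= 1] (convexity). *)
Lemma exprn_room (s c : R) (n : nat) :
  1 <= s -> 1 < c -> exists2 h, 0 < h & (s + h) ^+ n <= c * s ^+ n.
Proof.
move=> s1 c1; pose h : R := Num.min 1 ((c - 1) / 2 ^+ n).
have p2 : 0 < (2 : R) ^+ n by rewrite exprn_gt0.
have h_gt0 : 0 < h by rewrite lt_min ltr01 divr_gt0 // subr_gt0.
have h_le1 : h <= 1 by rewrite ge_min lexx.
have hc : 2 ^+ n * h <= c - 1.
  by rewrite mulrC -ler_pdivlMr // ge_min lexx orbT.
have chord k : (1 + h) ^+ k <= 1 + (2 ^+ k - 1) * h.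
  elim: k => [|k IHk]; first by rewrite !expr0 subrr mul0r addr0.
  have q1 : 1 <= (2 : R) ^+ k by rewrite exprn_ege1 // ler1n.
  have g : 0 <= (2 ^+ k - 1) * (h * (1 - h)).
    by rewrite !mulr_ge0 ?subr_ge0 // ltW.
  rewrite !exprS; apply: (@le_trans _ _ ((1 + h) * (1 + (2 ^+ k - 1) * h))).
    by rewrite ler_wpM2l // addr_ge0 // ltW.
  by lra.
exists h => //; apply: (@le_trans _ _ ((s * (1 + h)) ^+ n)).
  have sh : s + h <= s * (1 + h) by rewrite mulrDr mulr1 lerD2l ler_peMl // ltW.
  have sh_ge0 : 0 <= s + h by lra.
  by apply: lerXn2r; rewrite ?nnegrE // (le_trans sh_ge0).
rewrite exprMn mulrC ler_wpM2r ?exprn_ge0 //; first by lra.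
by have := chord n; nra.
Qed.

Definition growth (m n : nat) (A : 'M[quat R]_(m, n)) (X : 'M[quat R]_(n, m)) : R :=
  19 * (Num.max 1 (opnorm (1 - A *m X) ^+ 18)
        * (1 + 18 * opnorm A * opnorm X)).

Lemma growth_gt0 (m n : nat) (A : 'M[quat R]_(m, n)) (X : 'M[quat R]_(n, m)) :
  0 < growth A X.
Proof.
rewrite !mulr_gt0 ?ltr0n // ?lt_max ?ltr01 //.
by rewrite ltr_wpDr ?ltr01 // !mulr_ge0 ?opnorm_ge0.
Qed.

Lemma perturbation_factorE (m n : nat) (A : 'M[quat R]_(m, n))
    (X : nat -> 'M[quat R]_(n, m)) (j : nat) :
  perturbation_factor A X j = \prod_(0 <= i < j.+1) growth A (X i).
Proof.
by rewrite [RHS]big_split /= prodr_const_nat subn0.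
Qed.

(** The derivative of the step at [X] has norm at most
    [19 max(1, |R|^18) (1 + 9 |A| |X|)]; the gap between [9] and [18], which is
    genuine because [A X != 0], absorbs all terms of higher order. *)
Lemma qhpi19_step_local (m n : nat) (A : 'M[quat R]_(m, n))
    (X : 'M[quat R]_(n, m)) :
    A *m X != 0 ->
  exists2 eps : R, 0 < eps & forall Y, opnorm (Y - X) < eps ->
    opnorm (qhpi19_step A Y - qhpi19_step A X) <= growth A X * opnorm (Y - X).
Proof.
move=> AX0.
have A_gt0 : 0 < opnorm A.
  rewrite lt_def opnorm_ge0 andbT; apply: contraNneq AX0 => /opnorm_eq0 ->.
  by rewrite mul0mx.
have X_gt0 : 0 < opnorm X.
  rewrite lt_def opnorm_ge0 andbT; apply: contraNneq AX0 => /opnorm_eq0 ->.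
  by rewrite mulmx0.
set a := opnorm A in A_gt0 *; set x := opnorm X in X_gt0 *.
set r := opnorm (1 - A *m X); set s := Num.max 1 r.
have ax_gt0 : 0 < a * x by rewrite mulr_gt0.
have s1 : 1 <= s by rewrite le_max lexx.
have c1 : 1 < (1 + 18 * a * x) / (1 + 9 * a * x).
  by rewrite ltr_pdivlMr; nra.
have [h h_gt0 room] := exprn_room 18 s1 c1.
exists (h / a) => [|Y Yh]; first by rewrite divr_gt0.
have ah : a * opnorm (Y - X) <= h by rewrite mulrC -ler_pdivlMr // ltW.
have XL : r <= s + h by rewrite ler_wpDr ?(ltW h_gt0) // le_max lexx orbT.
have YL : opnorm (1 - A *m Y) <= s + h.
  have -> : 1 - A *m Y = (1 - A *m X) - A *m (Y - X).
    by rewrite mulmxBr opprB addrA subrK.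
  rewrite (le_trans (opnormD _ _)) // opnormN lerD //.
    by rewrite le_max lexx orbT.
  by rewrite (le_trans (opnormM _ _)).
have L1 : 1 <= s + h by lra.
apply: le_trans (qhpi19_step_lipschitz L1 XL YL) _.
apply: ler_wpM2r; first exact: opnorm_ge0.
rewrite /growth -/a -/x -/r.
have -> : Num.max 1 (r ^+ 18) = s ^+ 18.
  rewrite /s; have [r1|r1] := leP r 1.
    by rewrite expr1n max_l // exprn_ile1 // opnorm_ge0.
  by rewrite max_r // exprn_ege1 // ltW.
have b_gt0 : 0 < 1 + 9 * a * x by nra.
rewrite -mulrA ler_wpM2l // -ler_pdivlMr //.
by rewrite -(mulrA (s ^+ 18)) [leRHS]mulrC.
Qed.

End OneStep.

(** * Perturbations along an orbit *)

Section Orbit.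
Variables (R : realType) (m n : nat) (A : 'M[quat R]_(m, n)).

Definition is_orbit (X : nat -> 'M[quat R]_(n, m)) : Prop :=
  forall i, X i.+1 = qhpi19_step A (X i).

(** The geometric sum: [(1 - T) \sum_(k < 19) T ^+ k = 1 - T ^+ 19]. *)
Lemma orbit_residual X (i : nat) :
  is_orbit X -> 1 - A *m X i.+1 = (1 - A *m X i) ^+ 19.
Proof.
move=> hX; rewrite hX qhpi19_stepE mulmxA; set T := 1 - A *m X i.
have -> : A *m X i = 1 - T by rewrite opprB addrC subrK.
have := subrX1 T 19; rewrite -[(1 - T) *m _]/((1 - T) * _) -[1 - T]opprB mulNr => <-.
by rewrite opprK addrC subrK.
Qed.

(** The radius is chosen so that each iterate up to [j] stays where the one-step
    bound is valid. *)
Lemma orbit_local X (j : nat) :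
    is_orbit X -> (forall i, A *m X i != 0) ->
  exists2 eps : R, 0 < eps & forall Y, is_orbit Y ->
    opnorm (Y 0%N - X 0%N) < eps ->
    opnorm (Y j - X j)
      <= \prod_(0 <= i < j) growth A (X i) * opnorm (Y 0%N - X 0%N).
Proof.
move=> hX AX0; elim: j => [|j [eps eps_gt0 IHj]].
  by exists 1 => // Y _ _; rewrite big_geq // mul1r.
have [eta eta_gt0 step] := qhpi19_step_local (AX0 j).
set G := \prod_(0 <= i < j) growth A (X i) in IHj *.
have G_gt0 : 0 < G by apply: prodr_gt0 => i _; exact: growth_gt0.
exists (Num.min eps (eta / G)); first by rewrite lt_min eps_gt0 divr_gt0.
move=> Y hY; rewrite lt_min => /andP[Y_eps]; rewrite ltr_pdivlMr // => Y_eta.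
have Yj := IHj Y hY Y_eps.
rewrite hX hY big_nat_recr //= -/G; apply: le_trans (step _ _) _.
  by apply: le_lt_trans Yj _; rewrite mulrC.
rewrite [G * _]mulrC -[leRHS]mulrA; apply: ler_wpM2l; last exact: Yj.
exact/ltW/growth_gt0.
Qed.

(** The first columns of the two unitary factors. The two equations make [v] an
    eigenvector of [A A^H] for the square of the largest singular value. *)
Lemma singular_pair (sigma : seq R) :
    nonzero_singular_values A sigma -> (0 < size sigma)%N ->
  exists (v : 'cV[quat R]_m) (w : 'cV[quat R]_n),
    [/\ v != 0, A^H *m v = qreal sigma`_0 *: w & A *m w = qreal sigma`_0 *: v].
Proof.
move=> [le_size _ _ [U [V [[UU _] [VV _] defA]]]] size_gt0.
have := leq_trans size_gt0 le_size; rewrite leq_min => /andP[m_gt0 n_gt0].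
pose i0 := Ordinal m_gt0; pose j0 := Ordinal n_gt0.
set S := (\matrix_(i, j) _) in defA.
pose e : 'cV[quat R]_m := delta_mx i0 0; pose f : 'cV[quat R]_n := delta_mx j0 0.
have Sf : S *m f = qreal sigma`_0 *: e.
  rewrite -colE; apply/matrixP => i k; rewrite ord1 !mxE eqxx andbT.
  by rewrite -val_eqE /=; case: eqP => [->|_]; rewrite ?mulr1 ?mulr0.
have Se : S^H *m e = qreal sigma`_0 *: f.
  rewrite -colE; apply/matrixP => j k; rewrite ord1 !mxE eqxx andbT.
  rewrite -val_eqE [in RHS]eq_sym /=.
  by case: eqP => _; rewrite ?mulr1 ?mulr0 ?qconj_real ?raddf0.
exists (U *m e), (V *m f); split.
- apply: contraNneq (oner_neq0 (quat R)) => Ue0.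
  have /matrixP/(_ i0 0) : e = 0 by rewrite -[e]mul1mx -UU -mulmxA Ue0 mulmx0.
  by rewrite !mxE !eqxx => /eqP.
- rewrite defA !adjmxM adjmxK -!mulmxA [U^H *m _]mulmxA UU mul1mx Se.
  by rewrite !scalerealmxAr.
- by rewrite defA -!mulmxA [V^H *m _]mulmxA VV mul1mx Sf !scalerealmxAr.
Qed.

Lemma exprmx_eigen (k : nat) (B : 'M[quat R]_m) (v : 'cV[quat R]_m) (a : R) :
  B *m v = qreal a *: v -> B ^+ k *m v = qreal (a ^+ k) *: v.
Proof.
move=> Bv; elim: k => [|k IHk]; first by rewrite !expr0 mul1mx rmorph1 scale1r.
by rewrite exprSr exprS -mulmxA Bv scalerealmxAr IHk scalerA -rmorphM.
Qed.

(** Along a leading singular vector the residual acts as a scalar of modulus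
    less than [1], at index 0 by the choice of [alpha] and later because
    residuals are raised to the power 19; so the residual is never [1]. *)
Lemma orbit_mulmx_neq0 (sigma : seq R) (alpha : R) X (i : nat) :
    nonzero_singular_values A sigma -> (0 < size sigma)%N ->
    0 < alpha < 2 / sigma`_0 ^+ 2 ->
    X 0%N = qreal alpha *: A^H -> is_orbit X ->
  A *m X i != 0.
Proof.
move=> hsigma hr /andP[alpha_gt0 alpha_lt] hX0 hX.
have [v [w [v0 Av Aw]]] := singular_pair hsigma hr.
have s_gt0 : 0 < sigma`_0.
  by have [_ _ /allP pos _] := hsigma; apply/pos/mem_nth.
have [rho rho1 Rv] : exists2 rho : R, `|rho| < 1
    & (1 - A *m X i) *m v = qreal rho *: v.
  elim: i => [|i [rho rho1 Rv]].
    exists (1 - alpha * sigma`_0 ^+ 2).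
      have s2_gt0 : 0 < sigma`_0 ^+ 2 by rewrite exprn_gt0.
      rewrite ltr_pdivlMr // in alpha_lt.
      have := mulr_gt0 alpha_gt0 s2_gt0.
      by rewrite ltr_norml; move=> h; apply/andP; split; lra.
    rewrite mulmxBl mul1mx hX0 scalerealmxAr -scalemxAl -mulmxA Av.
    rewrite scalerealmxAr Aw !scalerA -!rmorphM /= rmorphB scalerBl rmorph1.
    by rewrite scale1r mulrA.
  exists (rho ^+ 19); first by rewrite normrX exprn_ilt1.
  by rewrite (orbit_residual _ hX) (exprmx_eigen _ Rv).
apply: contraTneq rho1 => AX0; move: Rv; rewrite AX0 subr0 mul1mx => Rv.
have rho0 : 1 - rho = 0.
  apply/eqP; apply: contraNT v0 => rho0.
  rewrite -[v]scale1r -(rmorph1 (@qreal R)) -(mulVf rho0) rmorphM -scalerA.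
  by rewrite rmorphB rmorph1 scalerBl scale1r -Rv subrr scaler0.
by rewrite (_ : rho = 1) ?normr1 ?ltxx //; lra.
Qed.

End Orbit.

(** * Conclusion *)

Theorem theorem7 (R : realType) (m n : nat) (A : 'M[quat R]_(m, n))
    (sigma : seq R) (alpha : R) (X : nat -> 'M[quat R]_(n, m))
    (hsigma : nonzero_singular_values A sigma)
    (hr : (0 < size sigma)%N)
    (halpha : 0 < alpha < 2 / sigma`_0 ^+ 2)
    (hX0 : X 0%N = qreal alpha *: A^H)
    (hX : forall i : nat, X i.+1 = qhpi19_step A (X i))
    (j : nat) :
  exists2 delta : R, 0 < delta &
    forall Xt : nat -> 'M[quat R]_(n, m),
      (forall i : nat, Xt i.+1 = qhpi19_step A (Xt i)) ->
      opnorm (Xt j - X j) < delta ->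
      opnorm (Xt j.+1 - X j.+1)
        <= perturbation_factor A X j * opnorm (Xt 0%N - X 0%N).
Proof.
have AX0 i : A *m X i != 0 by exact: orbit_mulmx_neq0 hsigma hr halpha hX0 hX.
have [eps eps_gt0 orbit] := orbit_local j hX AX0.
have [eta eta_gt0 step] := qhpi19_step_local (AX0 j).
rewrite perturbation_factorE big_nat_recr //=.
set G := \prod_(0 <= i < j) growth A (X i) in orbit *.
have G_gt0 : 0 < G by apply: prodr_gt0 => i _; exact: growth_gt0.
exists (Num.min eta (G * eps)); first by rewrite lt_min eta_gt0 mulr_gt0.
move=> Xt hXt; rewrite lt_min => /andP[Xt_eta Xt_eps].
rewrite hX hXt; apply: le_trans (step _ Xt_eta) _.
rewrite [G * _]mulrC -[leRHS]mulrA; apply: ler_wpM2l; first exact/ltW/growth_gt0.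
have [small|large] := ltP (opnorm (Xt 0%N - X 0%N)) eps.
  exact: orbit.
(* Here smallness at [j] does not come from smallness at 0, and [G * eps] bounds
   the perturbation at [j] by hypothesis. *)
apply: le_trans (ltW Xt_eps) _.
by apply: ler_wpM2l; first exact: ltW.
Qed.
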